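(* Let $n$ be a positive integer, let $\mathfrak A=(A_1,\dots,A_k)$ be an ordered partition of $[n]$ into $k$ nonempty blocks, and let $1\le r\le n$. Then: (i) the number of parking functions of length $n$ of type $\mathfrak A$ and the number of rook words of length $n$ of type $\mathfrak A$ are both equal to $\binom{n}{k-1}$; (ii) the number of parking functions $\mathbf a$ of length $n$ of type $\mathfrak A$ with $\operatorname{run}(\mathbf a)=r$ and the number of rook words $\mathbf a$ of length $n$ of type $\mathfrak A$ with $\operatorname{run}(\mathbf a)=r$ are both equal to $r\binom{n-r-1}{k-r}$.
   Context: Let $[n]=\{1,\dots,n\}$ and $\mathbf a=(a_1,\dots,a_n)\in[n]^n$. $\mathbf a$ is a parking function if $|\{j:a_j\le i\}|\ge i$ for every $i\in[n]$. If $1\in\{a_1,\dots,a_n\}$, $\operatorname{run}(\mathbf a)=\max\{i\in[n]:[i]\subseteq\{a_1,\dots,a_n\}\}$; otherwise $\operatorname{run}(\mathbf a)=0$. $\mathbf a$ is a rook word if $a_1\le\operatorname{run}(\mathbf a)$. The coimage $\operatorname{coim}(\mathbf a)$ is the ordered partition of $[n]$ into the nonempty fibers $\mathbf a^{-1}(\{x\})$, $x\in\{a_1,\dots,a_n\}$, listed in increasing order of $x$. $\mathbf a$ is of type $\mathfrak A=(A_1,\dots,A_k)$ if $\operatorname{coim}(\mathbf a)$ is a cyclic permutation of $\mathfrak A$, i.e. equals $(A_{j+1},\dots,A_k,A_1,\dots,A_j)$ for some $0\le j<k$. *)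

(* Defs.v *)
From mathcomp Require Import all_boot.
Set Implicit Arguments. Unset Strict Implicit. Unset Printing Implicit Defensive.

(* Convention: a word a = (a_1,...,a_n) in [n]^n is encoded as
   a : {ffun 'I_n -> 'I_n}, position j+1 <-> j : 'I_n, value v+1 <-> v : 'I_n.
   Subsets of [n] are encoded as {set 'I_n} (element i+1 <-> i). *)

Definition word n := {ffun 'I_n -> 'I_n}.

(* |{j : a_j <= i}| >= i for all i in [n]  (i = t+1, a_j = val (a j) + 1). *)
Definition parking n (a : word n) : bool :=
  [forall t : 'I_n, t.+1 <= #|[set j | a j <= t]|].

(* run(a) = max { m in [0,n] : [m] subset of {a_1..a_n} }  (m = 0 always qualifies;
   this coincides with the paper's definition, incl. run = 0 when 1 is not a value). *)
Definition run n (a : word n) : nat :=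
  \max_(m < n.+1 | [forall t : 'I_n, (t < m) ==> (t \in codom a)]) m.

(* rook word: a_1 <= run(a), i.e. val (a_1) + 1 <= run a *)
Definition rook n (a : word n) : bool :=
  [exists j : 'I_n, (val j == 0) && (a j < run a)].

Definition coim n (a : word n) : seq {set 'I_n} :=
  [seq F <- [seq a @^-1: pred1 x | x <- enum 'I_n] | F != set0].

Definition ordered_partition n (A : seq {set 'I_n}) : bool :=
  uniq A && partition [set B | B \in A] [set: 'I_n].

Definition of_type n (A : seq {set 'I_n}) (a : word n) : bool :=
  [exists j : 'I_(size A), coim a == rot j A].

(* Main.v *)
(* A word of type A is a rotation j of A together with its set of values, a k-subset
   of [n].  Write the indicator of that set as 1^r 0 1^(c_1) 0 1^(c_2) ... 0 1^(c_(n-k));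
   then r is the run and c_1 + ... + c_(n-k) = k - r.  The blocks have n - k surplus
   elements (all but one element of each block).  Attach c_e to the e-th surplus element
   and let kappa_l be the sum of the c_e over the l-th block of the rotation.  The word is
   parking iff the walk with start r and steps kappa_l - 1 is positive before its last
   step, where it reaches 0; it is rook iff the same holds when kappa is concentrated on
   the block of 1.  Rotating A and c together rotates kappa, so the cycle lemma gives
   exactly r good rotations for each of the C(n-r-1, k-r) sequences c.  Summing over r
   gives (i). *)
Require Import Defs.
From mathcomp Require Import all_boot zify.
Set Implicit Arguments. Unset Strict Implicit. Unset Printing Implicit Defensive.

(** * The cycle lemma *)

(** Since [h] falls by at most one per step, every strict new minimum lowers the running minimum by
    exactly one. Over the second period the running minimum falls by [r], so that period contains
    [r] records. *)
Lemma count_records (h : nat -> nat) (k r : nat) :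
    0 < k -> (forall i, h i <= (h i.+1).+1) ->
    (forall i, i < k -> h (i + k) + r = h i) ->
  count (fun j => all (fun b => h (j + k) < h (j + b)) (iota 0 k)) (iota 0 k) = r.
Proof.
move=> k_gt0 hstep hper.
(* The minimum of [h] below [m]; the value at 0 is a placeholder, and only [m > 0] matters. *)
pose M := fix M m := if m is m'.+1 then minn (M m') (h m') else h 0.
have M_le m i : i < m -> M m <= h i.
  elim: m => // m IH; rewrite ltnS leq_eqVlt => /predU1P[-> | /IH] /=; lia.
have M_attained m : 0 < m -> exists2 i, i < m & M m = h i.
  elim: m => // -[_ _ | m IH _]; first by exists 0 => //=; rewrite minnn.
  have [//|i ltim Mi] := IH.
  rewrite [M _]/(minn (M m.+1) (h m.+1)) Mi.
  case: ltnP => le_h; [exists i | exists m.+1]; lia.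
have record_step m : 0 < m -> (h m < M m) + M m.+1 = M m.
  case: m => // m _; have -> : M m.+2 = minn (M m.+1) (h m.+1) by [].
  have := hstep m; have := M_le m.+1 m (ltnSn m); lia.
have record_count m : count (fun j => h (j + k) < M (j + k)) (iota 0 m) + M (m + k) = M k.
  elim: m => [|m IH] //; rewrite -[m.+1]addn1 iotaD count_cat /= add0n addn0 addn1 -IH.
  by rewrite -addnA; congr (_ + _); apply: record_step; lia.
(* A minimizer in the first period, shifted by [k], gives one inequality; a minimizer over both
   periods, shifted back if it lies in the second, gives the other. *)
have Mdrop : M (k + k) + r = M k.
  have [i ltik Mi] := M_attained k k_gt0.
  have [|i' lti' Mi'] := M_attained (k + k); first by rewrite addn_gt0 k_gt0.
  apply/eqP; rewrite eqn_leq; apply/andP; split.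
    by rewrite Mi -(hper i ltik) leq_add2r; apply: M_le; lia.
  rewrite Mi'; case: (ltnP i' k) => lt_i'k.
    by apply: leq_trans (leq_addr _ _); apply: M_le.
  have -> : i' = (i' - k) + k by rewrite subnK.
  by rewrite hper; [apply: M_le | ]; lia.
(* Beating the last [k] values amounts to beating all earlier ones: an index [i] before [j] has
   [i + k] inside the window, with a value no larger. *)
have -> : count (fun j => all (fun b => h (j + k) < h (j + b)) (iota 0 k)) (iota 0 k)
        = count (fun j => h (j + k) < M (j + k)) (iota 0 k).
  apply: eq_in_count => j; rewrite mem_iota => /andP[_ ltjk].
  apply/allP/idP => [below | rec b]; last first.
    by rewrite mem_iota => /andP[_ ltbk]; apply: leq_trans rec _; apply: M_le; lia.
  have [|i ltijk ->] := M_attained (j + k); first by rewrite addn_gt0 k_gt0 orbT.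
  have below' i' : j <= i' -> i' < j + k -> h (j + k) < h i'.
    move=> leji' lti'; have := below (i' - j); rewrite mem_iota subnKC //; apply; lia.
  case: (leqP j i) => [/below' | ltij]; first exact.
  by rewrite -(hper i); [apply: leq_trans (below' (i + k) _ _) (leq_addr _ _) | ]; lia.
by apply/eqP; rewrite -(eqn_add2r (M (k + k))) record_count addnC Mdrop.
Qed.

(** Positivity, before its last step, of the walk with start [r] and steps [s_i - 1], written
    without subtraction. *)
Definition stays_pos (r : nat) (s : seq nat) : bool :=
  all (fun b => b < r + sumn (take b s)) (iota 0 (size s)).

Lemma sumn_take_rot (s : seq nat) j b : j <= size s -> b <= size s ->
  sumn (take j s) + sumn (take b (rot j s)) = sumn (take (j + b) (s ++ s)).
Proof.
move=> lej leb; rewrite -sumn_cat; congr sumn.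
rewrite -{3 4}(cat_take_drop j s) -catA (catA (drop j s)).
rewrite takeD take_size_cat ?size_takel //; congr (_ ++ _).
rewrite drop_size_cat ?size_takel // -[drop j s ++ take j s]/(rot j s).
by rewrite takel_cat // size_rot.
Qed.

Lemma leq_sumn_take (s : seq nat) i j : i <= j -> sumn (take i s) <= sumn (take j s).
Proof. by move=> leij; rewrite -(subnKC leij) takeD sumn_cat leq_addr. Qed.

Lemma cycle_lemma (r : nat) (s : seq nat) :
  0 < size s -> sumn s + r = size s ->
  count (fun j => stays_pos r (rot j s)) (iota 0 (size s)) = r.
Proof.
move=> s_gt0 sum_s; set k := size s.
(* The walk along two copies of [s], raised to stay in [nat]. Past [k + k] it is constant, so it
   still never falls by more than one. *)
pose h i := k + k - i + sumn (take i (s ++ s)).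
have hlow j : j <= k -> sumn (take j (s ++ s)) = sumn (take j s).
  by move=> lejk; rewrite takel_cat.
have hhigh j : j <= k -> sumn (take (j + k) (s ++ s)) = sumn (take j s) + sumn s.
  by move=> lejk; rewrite -sumn_take_rot // [take k _]take_oversize ?size_rot // sumn_rot.
rewrite -[RHS](@count_records h k r) //; last first.
- by move=> i ltik; rewrite /h (hlow i) ?hhigh ?(ltnW ltik) //; rewrite /k in ltik *; lia.
- move=> i; rewrite /h; have := leq_sumn_take (s ++ s) (leqnSn i); lia.
apply: eq_in_count => j; rewrite mem_iota add0n => /andP[_ ltjk].
rewrite /stays_pos size_rot; apply: eq_in_all => b; rewrite mem_iota add0n => /andP[_ ltbk].
rewrite /h hhigh ?(ltnW ltjk) // -sumn_take_rot ?(ltnW ltjk) ?(ltnW ltbk) //.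
rewrite /k in ltjk ltbk *; lia.
Qed.

(** * Sums over consecutive blocks, and compositions *)

Definition block_sums (z c : seq nat) : seq nat := map sumn (reshape z c).

Lemma size_block_sums z c : size (block_sums z c) = size z.
Proof. by rewrite size_map size_reshape. Qed.

Lemma sumn_take_block_sums z c b :
  sumn (take b (block_sums z c)) = sumn (take (sumn (take b z)) c).
Proof.
elim: z b c => [|m z IH] [|b] c /=; rewrite ?take0 //.
by rewrite IH takeD sumn_cat.
Qed.

Lemma sumn_block_sums z c : size c <= sumn z -> sumn (block_sums z c) = sumn c.
Proof.
move=> lec; have := sumn_take_block_sums z c (size z).
by rewrite !take_oversize ?size_block_sums.
Qed.

Lemma block_sums_cat z1 z2 c1 c2 : size c1 = sumn z1 ->
  block_sums (z1 ++ z2) (c1 ++ c2) = block_sums z1 c1 ++ block_sums z2 c2.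
Proof.
elim: z1 c1 => [|m z1 IH] c1 /=; first by move/size0nil ->.
move=> szc; rewrite /block_sums /= -!/(block_sums _ _).
have lem : m <= size c1 by rewrite szc leq_addr.
rewrite takel_cat // drop_cat; congr (_ :: _).
case: ltnP => [ltm | gem]; first by rewrite IH // size_drop szc addKn.
have em : m = size c1 by apply/eqP; rewrite eqn_leq lem.
have z10 : sumn z1 = 0 by lia.
by rewrite em subnn drop0 drop_size -IH // z10.
Qed.

(** Moving the first [j] blocks to the end moves exactly their [sumn (take j z)] entries of [c]. *)
Lemma block_sums_rot z c j : size c = sumn z ->
  block_sums (rot j z) (rot (sumn (take j z)) c) = rot j (block_sums z c).
Proof.
move=> szc; case: (ltnP j (size z)) => [ltj | lej]; last first.
  by rewrite take_oversize // !rot_oversize ?size_block_sums // szc.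
set e := sumn _; have lee : e <= size c.
  by rewrite szc -(cat_take_drop j z) sumn_cat leq_addr.
have szt : size (take e c) = e by rewrite size_takel.
have szd : size (drop e c) = sumn (drop j z).
  by rewrite size_drop szc -{1}(cat_take_drop j z) sumn_cat addKn.
have -> : block_sums z c = block_sums (take j z) (take e c) ++ block_sums (drop j z) (drop e c).
  by rewrite -block_sums_cat // !cat_take_drop.
have szj : size (block_sums (take j z) (take e c)) = j.
  by rewrite size_block_sums size_takel // ltnW.
by rewrite /rot block_sums_cat // drop_size_cat ?take_size_cat.
Qed.

(** Weak compositions of [d] into [m] parts: zero parts are allowed. *)
Fixpoint comps (m d : nat) : seq (seq nat) :=
  if m is m'.+1 then [seq i :: c | i <- iota 0 d.+1, c <- comps m' (d - i)]
  else if d is 0 then [:: [::]] else [::].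

Lemma mem_comps m d c : (c \in comps m d) = (size c == m) && (sumn c == d).
Proof.
elim: m d c => [|m IH] d c; first by case: d; case: c => //= x c; rewrite ?inE ?eqseqE.
apply/allpairsPdep/idP => [[i [c' [iP]]] | ].
  rewrite IH => /andP[/eqP sz /eqP sm] -> /=; rewrite sz eqxx /= sm.
  by move: iP; rewrite mem_iota; lia.
case: c => // i c /=; rewrite eqSS => /andP[sz /eqP sm].
exists i, c; split=> //; first by rewrite inE mem_iota; lia.
by rewrite IH sz; apply/eqP; lia.
Qed.

Lemma comps_uniq m d : uniq (comps m d).
Proof.
elim: m d => [|m IH] d; first by case: d.
by apply: allpairs_uniq_dep => [||[i c] [i' c'] _ _ /= [-> ->]] //; apply: iota_uniq.
Qed.

(** Rotation permutes the compositions, so each rotation of the blocks may later be paired with its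
    own rotation of [c]. *)
Lemma count_comps_rot m d e (P : pred (seq nat)) :
  count (fun c => P (rot e c)) (comps m d) = count P (comps m d).
Proof.
have /permP/(_ P) <- : perm_eq (map (rot e) (comps m d)) (comps m d).
  apply: uniq_perm; rewrite ?map_inj_uniq ?comps_uniq //; first exact: rot_inj.
  move=> c; apply/mapP/idP => [[c' + ->] | ].
    by rewrite !mem_comps size_rot sumn_rot.
  rewrite mem_comps => c_in; exists (rotr e c); last by rewrite rotrK.
  by rewrite mem_comps size_rotr -(sumn_rot _ e) rotrK.
by rewrite count_map.
Qed.

(** Hockey-stick identity, by Pascal's rule. *)
Lemma sum_bin_comps m k : \sum_(d < k.+1) 'C(m + d - 1, d) = 'C(m + k, k).
Proof.
elim: k => [|k IH]; first by rewrite big_ord_recl big_ord0 !bin0.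
by rewrite big_ord_recr IH /= addnS subn1 /= binS addnC.
Qed.

(** Stars and bars, by recursion on the first part. At [m = d = 0] truncated subtraction gives the
    correct value 1. *)
Lemma size_comps m d : size (comps m d) = 'C(m + d - 1, d).
Proof.
elim: m d => [|m IH] d; first by case: d => //= d; rewrite add0n subn1 bin_small.
rewrite size_allpairs_dep sumnE big_map.
under eq_bigr do rewrite IH.
rewrite -[iota 0 d.+1]/(index_iota 0 d.+1) big_mkord.
rewrite addSn subn1 -(sum_bin_comps m d) (reindex_inj rev_ord_inj) /=.
by apply: eq_bigr => i _; rewrite subSS subKn // -ltnS.
Qed.

(** Split the weight [r] as [1 + (r - 1)]: the ones give a hockey-stick sum, the rest is the
    induction hypothesis, and Pascal's rule joins them. *)
Lemma sum_run_bin m k :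
  \sum_(r < k.+2) r * 'C(m + (k.+1 - r) - 1, k.+1 - r) = 'C(m + k.+1, k).
Proof.
elim: k => [|k IH].
  by rewrite !big_ord_recl big_ord0 /= !bin0.
rewrite big_ord_recl [X in X + _ = _]mul0n add0n.
under eq_bigr => i _ do rewrite /= /bump /= add1n subSS mulSn.
rewrite big_split /= IH (addnS m k.+1) binS; congr (_ + _).
rewrite -(sum_bin_comps m k.+1) [RHS](reindex_inj rev_ord_inj) /=.
by apply: eq_bigr => i _; have -> : k.+2 - i.+1 = k.+1 - i by lia.
Qed.

(** * Value sets as sequences of gaps *)

(** Read as the indicator of a set of values, [c] has one entry per missing value: the number of
    present values between it and the next missing one. *)
Fixpoint enc (r : nat) (c : seq nat) : bitseq :=
  nseq r true ++ (if c is m :: c' then false :: enc m c' else [::]).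

Lemma enc_nil r : enc r [::] = nseq r true.
Proof. exact: cats0. Qed.

Lemma enc_cons r m c : enc r (m :: c) = nseq r true ++ false :: enc m c.
Proof. by []. Qed.

Lemma count_enc_true r c : count id (enc r c) = r + sumn c.
Proof.
elim: c r => [|m c IH] r; first by rewrite enc_nil count_nseq mul1n addn0.
by rewrite enc_cons count_cat count_nseq mul1n /= IH.
Qed.

Lemma count_enc_false r c : count negb (enc r c) = size c.
Proof.
elim: c r => [|m c IH] r; first by rewrite enc_nil count_nseq.
by rewrite enc_cons count_cat count_nseq /= IH.
Qed.

Lemma size_enc r c : size (enc r c) = r + sumn c + size c.
Proof. by rewrite -(count_predC id) count_enc_true -(count_enc_false r c). Qed.

Lemma index_false_enc r c : index false (enc r c) = r.
Proof.
case: c => [|m c]; rewrite ?enc_nil ?enc_cons ?index_cat.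
  by rewrite memNindex ?size_nseq // mem_nseq andbF.
by rewrite mem_nseq andbF size_nseq /= addn0.
Qed.

Lemma enc_inj r r' c c' : enc r c = enc r' c' -> r = r' /\ c = c'.
Proof.
move=> eqe; have er : r = r' by rewrite -(index_false_enc r c) eqe index_false_enc.
split=> //; subst r'; elim: c c' r eqe => [|m c IH] c' r eqe.
  by apply/esym/size0nil; rewrite -(count_enc_false r c') -eqe count_enc_false.
case: c' eqe => [|m' c'] eqe.
  by have := congr1 (count negb) eqe; rewrite !count_enc_false.
move: eqe; rewrite !enc_cons => /eqP.
rewrite eqseq_cat // eqxx eqseq_cons eqxx /= => /eqP eqe.
have em : m = m' by rewrite -(index_false_enc m c) eqe index_false_enc.
by subst m'; rewrite (IH _ _ eqe).
Qed.

Lemma enc_surj b : exists c, b = enc (index false b) c.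
Proof.
elim: b => [|x b [c Eb]]; first by exists [::].
case: x; [exists c | exists (index false b :: c)]; rewrite {1}Eb //.
by have -> : index false (true :: b) = (index false b).+1 by []; case: c {Eb}.
Qed.

Lemma take_nseq_cat r q (s : bitseq) : take (r + q) (nseq r true ++ s) = nseq r true ++ take q s.
Proof. by rewrite takeD take_size_cat ?drop_size_cat ?size_nseq. Qed.

(** The prefix taken is the one that ends with [false] number [e], counting from 0. *)
Lemma ones_upto_false r c e : e < size c ->
  count id (take (r + sumn (take e c) + e.+1) (enc r c)) = r + sumn (take e c).
Proof.
elim: c r e => [|m c IH] r [|e] //= lte; rewrite -addnA take_nseq_cat count_cat count_nseq mul1n.
  by rewrite add0n /= take0.
by rewrite addnS /= IH.
Qed.

(** A prefix with [f] zeros reaches past zero number [f], hence contains the first run and the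
    [f - 1] runs between its zeros. *)
Lemma ones_before_false r c p (f := count negb (take p (enc r c))) :
  0 < f -> r + sumn (take f.-1 c) <= count id (take p (enc r c)).
Proof.
rewrite {}/f; elim: c r p => [|m c IH] r p.
  by rewrite enc_nil -has_count => /hasP[x /mem_take]; rewrite mem_nseq => /andP[_ /eqP->].
rewrite enc_cons; case: (leqP p r) => [lepr | /subnKC <-].
  by rewrite takel_cat ?size_nseq // take_nseq // count_nseq.
rewrite addSnnS take_nseq_cat !count_cat !count_nseq mul1n /= add0n add1n /= => _.
rewrite leq_add2l; case E: (count _ _) => [|f] //=.
by have := IH m (p - r.+1); rewrite E; apply.
Qed.

Lemma sumn_take_predn z o : all (leq 1) z -> o <= size z ->
  sumn (take o z) = o + sumn (take o (map predn z)).
Proof. by elim: z o => [|m z IH] [|o] //= /andP[m_gt0 z_gt0] leo; rewrite IH //; lia. Qed.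

(* Both sides say that the walk started at [r] which steps down by one at each
   block and up by [c_e] at the e-th surplus element is positive before its last
   step: on the left it is probed at the empty values, on the right at the blocks. *)
Lemma parking_enc z r c :
    all (leq 1) z -> size z = r + sumn c -> sumn z = size z + size c ->
  all (fun p => p <= sumn (take (count id (take p (enc r c))) z)) (iota 1 (sumn z))
    = stays_pos r (block_sums (map predn z) c).
Proof.
move=> z_gt0 szz smz; set b := enc r c.
have szb : size b = sumn z by rewrite size_enc smz szz.
have split_take p : p <= size b -> count id (take p b) + count negb (take p b) = p.
  by move=> lep; rewrite (count_predC id) size_takel.
have le_ones p : count id (take p b) <= size z.
  by rewrite szz -(count_enc_true r c) -/b -{2}(cat_take_drop p b) count_cat leq_addr.
have surplus : sumn (map predn z) = size c.
  have := sumn_take_predn z_gt0 (leqnn (size z)).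
  by rewrite !take_oversize ?size_map //; lia.
apply/allP/allP => [park q | pos p].
  rewrite mem_iota add0n size_block_sums size_map sumn_take_block_sums => /andP[_ ltq].
  rewrite ltnNge; apply/negP; set e := sumn (take q _) => le_q.
  case: (ltnP e (size c)) => [lte | gee]; last first.
    by move: le_q; rewrite take_oversize // -szz leqNgt ltq.
  have := park (r + sumn (take e c) + e.+1).
  rewrite ones_upto_false // (sumn_take_predn z_gt0) ?(leq_trans le_q (ltnW ltq)) //.
  have := leq_sumn_take (map predn z) le_q; rewrite -/e => le_e.
  have le_s : sumn (take e c) <= sumn c by rewrite -{2}(cat_take_drop e c) sumn_cat leq_addr.
  by rewrite mem_iota smz szz; lia.
rewrite mem_iota => /andP[p_gt0]; rewrite add1n ltnS -szb => lep.
(* The prefix has as many blocks as ones, each with one element plus its surplus. Failure at [p]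
   thus means fewer surplus elements than zeros. *)
rewrite (sumn_take_predn z_gt0) // -{1}(split_take p lep) leq_add2l leqNgt; apply/negP => lt_f.
set o := count id _ in lt_f.
have [lto | geo] := ltnP o (size z); last first.
  have {}geo : size (map predn z) <= o by rewrite size_map.
  move: lt_f; rewrite (take_oversize geo) surplus -(count_enc_false r c).
  by rewrite -{1}(cat_take_drop p (enc r c)) count_cat ltnNge leq_addr.
(* The height of the walk at block [o] uses only gaps lying before the last zero of the prefix,
   whose ones number at most [o]; so it is not positive. *)
have := pos o; rewrite mem_iota size_block_sums size_map lto sumn_take_block_sums => /(_ isT).
rewrite ltnNge => /negP; apply; apply: leq_trans (ones_before_false _); last first.
  exact: leq_ltn_trans lt_f.
rewrite leq_add2l; apply: leq_sumn_take.
by rewrite -ltnS prednK //; apply: leq_ltn_trans lt_f.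
Qed.

(** * Words of a given coimage *)

Definition bits n (a : word n) : bitseq := [seq x \in codom a | x <- enum 'I_n].

Lemma size_bits n (a : word n) : size (bits a) = n.
Proof. by rewrite size_map size_enum_ord. Qed.

Lemma mask_bits n (a : word n) : mask (bits a) (enum 'I_n) = [seq x <- enum 'I_n | x \in codom a].
Proof. by rewrite filter_mask. Qed.

Lemma coimE n (a : word n) :
  coim a = [seq a @^-1: pred1 x | x <- mask (bits a) (enum 'I_n)].
Proof.
rewrite mask_bits /coim filter_map; congr map; apply: eq_filter => x /=.
apply/set0Pn/codomP => [[y] | [y ->]]; last by exists y; rewrite !inE.
by rewrite !inE => /eqP <-; exists y.
Qed.

Lemma size_coim n (a : word n) : size (coim a) = count id (bits a).
Proof. by rewrite coimE size_map size_mask ?size_bits ?size_enum_ord. Qed.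

(** Equal value sets list the fibers over the same values, so equal coimages force equal fibers. *)
Lemma word_inj n (a a' : word n) : coim a = coim a' -> bits a = bits a' -> a = a'.
Proof.
rewrite !coimE => + eqb; rewrite -eqb => /eq_in_map eqf; apply/ffunP => x.
have /eqf/setP/(_ x) : a x \in mask (bits a) (enum 'I_n).
  by rewrite mask_bits mem_filter mem_enum codom_f.
by rewrite !inE eqxx => /esym/eqP.
Qed.

(** If no value is missing, [index] returns the length [n], which is then the run. *)
Lemma run_bits n (a : word n) : run a = index false (bits a).
Proof.
set i := index _ _; have lei : i <= n by rewrite -(size_bits a) index_size.
have nth_bits (t : 'I_n) : nth false (bits a) t = (t \in codom a).
  by rewrite (nth_map t) ?size_enum_ord // nth_ord_enum.
apply/eqP; rewrite eqn_leq; apply/andP; split.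
  apply/bigmax_leqP => m /forallP all_m; rewrite leqNgt; apply/negP => ltim.
  have lti : i < n by apply: leq_trans ltim _; rewrite -ltnS.
  have := all_m (Ordinal lti); rewrite ltim -nth_bits /= nth_index //.
  by rewrite -index_mem size_bits.
rewrite -ltnS in lei; apply: (leq_bigmax_cond (Ordinal lei)).
apply/forallP => t; apply/implyP => /= ltti; rewrite -nth_bits.
by have := before_find false ltti; case: nth.
Qed.

Lemma take_enum_ord n p : p <= n -> [seq v : 'I_n <- enum 'I_n | v < p] = take p (enum 'I_n).
Proof.
move=> lep; apply: (inj_map val_inj); rewrite map_take val_enum_ord take_iota.
by rewrite -(filter_map val (fun v => v < 0 + p)) val_enum_ord filter_iota_ltn // (minn_idPl lep).
Qed.

(** The positions with value below [p] fill the fibers over the present values below [p], and these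
    are the first blocks of the coimage. *)
Lemma parking_bits n (a : word n) :
  let sizes := [seq #|F : {set 'I_n}| | F <- coim a] in
  parking a = all (fun p => p <= sumn (take (count id (take p (bits a))) sizes)) (iota 1 n).
Proof.
move=> sizes.
have le_count p : p <= n ->
    #|[set j | a j < p]| = sumn (take (count id (take p (bits a))) sizes).
  move=> lep; rewrite /sizes coimE -map_comp -map_take sumnE big_map /=.
  have -> : take (count id (take p (bits a))) (mask (bits a) (enum 'I_n))
          = [seq v <- take p (enum 'I_n) | v \in codom a].
    rewrite -{2}(cat_take_drop p (bits a)) -{1}(cat_take_drop p (enum 'I_n)).
    rewrite mask_cat ?size_take ?size_bits ?size_enum_ord // take_size_cat.
      by rewrite /bits -map_take filter_mask.
    by rewrite size_mask // !size_take size_bits size_enum_ord.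
  rewrite -take_enum_ord // big_filter big_filter_cond big_enum_cond /=.
  rewrite -sum1_card (partition_big a (fun v => v < p)) => [|j]; last by rewrite inE.
  rewrite [RHS]big_mkcondr /=; apply: eq_bigr => v ltvp.
  rewrite (eq_bigl (mem (a @^-1: pred1 v))) => [|j]; last first.
    by rewrite !inE; case: eqP => [->|]; rewrite ?ltvp ?andbF.
  rewrite sum1_card; case: ifP => // /negP v_notin; apply: eq_card0 => j.
  by rewrite !inE; apply/eqP => ajv; case: v_notin; rewrite -ajv codom_f.
apply/forallP/allP => [park p | park t].
  rewrite mem_iota; case: p => // p; rewrite add1n !ltnS => /andP[_ ltpn].
  by rewrite -le_count //; apply: (park (Ordinal ltpn)).
by have := park t.+1; rewrite mem_iota !add1n !ltnS ltn_ord -le_count //; apply.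
Qed.

(** Elements of block number [i] receive the [i]-th value marked in [b]. The default [x] is never
    reached when [B] is an ordered partition with as many blocks as [b] has ones. *)
Definition mkword n (B : seq {set 'I_n}) (b : bitseq) : word n :=
  [ffun x => nth x (mask b (enum 'I_n)) (find (fun F : {set 'I_n} => x \in F) B)].

Section OrderedPartition.
Variables (n : nat) (B : seq {set 'I_n}).
Hypothesis B_part : ordered_partition B.

Lemma block_neq0 F : F \in B -> F != set0.
Proof.
move=> FB; have /andP[_ /and3P[_ _]] := B_part.
by apply: contraNneq => <-; rewrite inE.
Qed.

Lemma has_block x : has (fun F : {set 'I_n} => x \in F) B.
Proof.
have /andP[_ /cover_partition covB] := B_part.
have : x \in cover [set F | F \in B] by rewrite covB inE.
by case/bigcupP => F; rewrite inE => FB xF; apply/hasP; exists F.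
Qed.

Lemma find_block x i : i < size B ->
  (x \in nth set0 B i) = (find (fun F : {set 'I_n} => x \in F) B == i).
Proof.
have /andP[uniqB /partition_trivIset triv] := B_part.
move=> lti; apply/idP/eqP => [xi | <-]; last exact: nth_find (has_block x).
set j := find _ _; have ltj : j < size B by rewrite -has_find has_block.
have xj : x \in nth set0 B j by apply: nth_find (has_block x).
apply/eqP; rewrite -(nth_uniq set0 ltj lti uniqB); apply/eqP.
rewrite -(def_pblock triv _ xj) ?inE ?mem_nth //.
by rewrite (def_pblock triv _ xi) ?inE ?mem_nth.
Qed.

Lemma count_block x : count (fun F : {set 'I_n} => x \in F) B = 1.
Proof.
have /andP[uniqB _] := B_part; set i := find (fun F : {set 'I_n} => x \in F) B.
have lti : i < size B by rewrite -has_find has_block.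
have xE F : F \in B -> (x \in F) = (F == nth set0 B i).
  by case/(nthP set0) => j ltj <-; rewrite find_block // nth_uniq // eq_sym.
by rewrite (eq_in_count xE) count_uniq_mem ?mem_nth.

Qed.

Lemma sum_block_sizes : sumn [seq #|F : {set 'I_n}| | F <- B] = n.
Proof.
have /andP[uniqB /card_partition card_B] := B_part.
rewrite sumnE big_map (big_uniq _ uniqB) -[RHS]card_ord -cardsT card_B.
by apply: eq_bigl => F; rewrite inE.
Qed.

Lemma block_sizes_gt0 : all (leq 1) [seq #|F : {set 'I_n}| | F <- B].
Proof. by rewrite all_map; apply/allP => F /block_neq0; rewrite /= card_gt0. Qed.

Lemma size_ordered_partition : size B <= n.
Proof.
apply: leq_trans (eq_leq sum_block_sizes).
elim: B block_sizes_gt0 => //= F s IH /andP[F_gt0 /IH le_s].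
by rewrite -add1n leq_add.
Qed.

Lemma ordered_partition_rot j : ordered_partition (rot j B).
Proof.
have /andP[uniqB part] := B_part; rewrite /ordered_partition rot_uniq uniqB /=.
by have -> : [set F | F \in rot j B] = [set F | F \in B] by apply/setP => F; rewrite !inE mem_rot.
Qed.

Variable b : bitseq.
Hypotheses (size_b : size b = n) (count_b : count id b = size B).

Let s := mask b (enum 'I_n).

Let size_s : size s = size B.
Proof. by rewrite size_mask ?size_enum_ord. Qed.

Let s_uniq : uniq s.
Proof. by rewrite mask_uniq ?enum_uniq. Qed.

Let mkword_eq x i y0 : i < size B -> (mkword B b x == nth y0 s i) = (x \in nth set0 B i).
Proof.
move=> lti; rewrite ffunE (set_nth_default x y0) ?size_s //.
by rewrite nth_uniq ?size_s -?has_find ?has_block // find_block.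
Qed.

Lemma codom_mkword : codom (mkword B b) =i s.
Proof.
move=> y; apply/codomP/idP => [[x ->] | ys].
  by rewrite ffunE mem_nth // size_s -has_find has_block.
have lti : index y s < size B by rewrite -size_s index_mem.
have /set0Pn[x] := block_neq0 (mem_nth set0 lti).
by rewrite -(mkword_eq x y lti) nth_index // => /eqP; exists x.
Qed.

Lemma bits_mkword : bits (mkword B b) = b.
Proof.
apply: (@eq_from_nth _ false) => [|i]; rewrite size_bits // => lti.
rewrite (nth_map (Ordinal lti)) ?size_enum_ord // codom_mkword.
rewrite in_mask ?enum_uniq // mem_enum index_uniq ?enum_uniq //.
by rewrite size_enum_ord.
Qed.

Lemma coim_mkword : coim (mkword B b) = B.
Proof.
rewrite coimE bits_mkword; apply: (@eq_from_nth _ set0); rewrite size_map // => i.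
rewrite size_s => lti; apply/setP => x.
rewrite (nth_map x) ?size_s // !inE.
exact: mkword_eq.
Qed.

End OrderedPartition.

(** * Counting *)

Lemma rot_index_inj (T : eqType) (s : seq T) i j :
  uniq s -> i < size s -> j < size s -> rot i s = rot j s -> i = j.
Proof.
case: s => // x0 s uniqs lti ltj /(congr1 (fun t => nth x0 t 0)).
rewrite /rot !nth_cat !size_drop !subn_gt0 lti ltj !nth_drop !addn0 => /eqP.
by rewrite nth_uniq // => /eqP.
Qed.

Lemma sumn_map_indicator (T : Type) (P : pred T) d s :
  sumn [seq P y * d | y <- s] = count P s * d.
Proof. by elim: s => //= y s ->; rewrite mulnDl. Qed.

Section Counting.
Variables (n : nat) (A : seq {set 'I_n}).
Hypothesis A_part : ordered_partition A.
Let k := size A.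

(** Such words correspond bijectively to pairs of a rotation [j] and a composition [c]: the coimage
    determines [j] because the blocks are distinct, and the value set determines [c]. *)
Lemma card_words_of_type r (Q : pred (word n)) : r <= k ->
  #|[set a : word n | [&& Q a, run a == r & of_type A a]]|
    = \sum_(j <- iota 0 k)
        count (fun c => Q (mkword (rot j A) (enc r c))) (comps (n - k) (k - r)).
Proof.
move=> lerk; have lekn : k <= n := size_ordered_partition A_part.
have enc_spec c : c \in comps (n - k) (k - r) ->
    size (enc r c) = n /\ count id (enc r c) = k.
  by rewrite mem_comps size_enc count_enc_true => /andP[/eqP-> /eqP->]; lia.
have word_spec j c : c \in comps (n - k) (k - r) ->
    coim (mkword (rot j A) (enc r c)) = rot j A /\ bits (mkword (rot j A) (enc r c)) = enc r c.
  case/enc_spec => sz ct; have rotP := ordered_partition_rot A_part j.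
  by rewrite coim_mkword ?bits_mkword ?size_rot.
pose L := [seq mkword (rot j A) (enc r c)
  | j <- iota 0 k, c <- [seq c <- comps (n - k) (k - r) | Q (mkword (rot j A) (enc r c))]].
have uniqL : uniq L.
  apply: allpairs_uniq_dep => [|j _|]; rewrite ?iota_uniq ?filter_uniq ?comps_uniq //.
  move=> _ _ /allpairsPdep[j [c [jk + ->]]] /allpairsPdep[j' [c' [j'k + ->]]] /=.
  rewrite !mem_filter => /andP[_ cL] /andP[_ c'L] eqw.
  have [coimE bitsE] := word_spec j c cL; have [coimE' bitsE'] := word_spec j' c' c'L.
  have [_ ->] : r = r /\ c = c' by apply: enc_inj; rewrite -bitsE -bitsE' eqw.
  rewrite (@rot_index_inj _ A j j') //.
  - by case/andP: A_part.
  - by move: jk; rewrite mem_iota.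
  - by move: j'k; rewrite mem_iota.
  - by rewrite -coimE -coimE' eqw.
have memL : [set a : word n | [&& Q a, run a == r & of_type A a]] =i L.
  move=> a; rewrite inE; apply/and3P/allpairsPdep.
    case=> Qa /eqP run_a /existsP[j /eqP coim_a].
    have [c bits_a] := enc_surj (bits a); rewrite -run_bits run_a in bits_a.
    have sz := size_bits a; have ct := size_coim a.
    rewrite bits_a count_enc_true coim_a size_rot -/k in ct.
    rewrite bits_a size_enc in sz.
    have cL : c \in comps (n - k) (k - r) by rewrite mem_comps -sz -ct addKn ct addKn !eqxx.
    have [coimE bitsE] := word_spec j c cL.
    have aE : a = mkword (rot j A) (enc r c) by apply: word_inj; rewrite ?coimE ?bitsE.
    exists (nat_of_ord j), c; split=> //; first by rewrite mem_iota /=.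
    by rewrite mem_filter -aE Qa.
  case=> j [c [+ + ->]]; rewrite mem_iota mem_filter => /andP[_ ltj] /andP[Qjc cL].
  have [coimE bitsE] := word_spec j c cL.
  rewrite run_bits bitsE index_false_enc; split=> //.
  by apply/existsP; exists (Ordinal ltj); rewrite coimE.
rewrite (eq_card memL) (card_uniqP uniqL) size_allpairs_dep sumnE big_map.
by apply: eq_bigr => j _; rewrite size_filter.
Qed.

Lemma run_le_size a : of_type A a -> run a <= k.
Proof.
case/existsP => j /eqP coim_a; rewrite run_bits /k -(size_rot j A) -coim_a size_coim.
have [c ->] := enc_surj (bits a).
by rewrite index_false_enc count_enc_true leq_addr.
Qed.

(** For each [j], first rotate [c] by [e j]; then exchange the sums, so that for fixed [c] the cycle
    lemma applied to [f c] counts exactly [r] good rotations. *)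
Lemma card_run_of_type r (Q : pred (word n)) (f : seq nat -> seq nat) (e : nat -> nat) :
    (forall c, size c = n - k -> size (f c) = k) ->
    (forall c, size c = n - k -> sumn (f c) = sumn c) ->
    0 < k -> r <= k ->
    (forall j c, j < k -> c \in comps (n - k) (k - r) ->
       Q (mkword (rot j A) (enc r (rot (e j) c))) = stays_pos r (rot j (f c))) ->
  #|[set a : word n | [&& Q a, run a == r & of_type A a]]| = r * 'C(n - r - 1, k - r).
Proof.
move=> size_f sum_f k_gt0 lerk QE.
have lekn : k <= n := size_ordered_partition A_part.
rewrite card_words_of_type //.
under eq_big_seq => j.
  rewrite mem_iota => /andP[_ ltj].
  rewrite -(count_comps_rot _ _ (e j)) (eq_in_count (QE j ^~ ltj)).
  over.
under eq_bigr do rewrite -sum1_count big_mkcond.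
rewrite exchange_big /=.
under eq_big_seq => c.
  rewrite mem_comps => /andP[/eqP sz /eqP sm].
  rewrite -big_mkcond sum1_count -(size_f c sz) cycle_lemma ?size_f ?sum_f ?sm ?subnK //.
  over.
rewrite big_const_seq count_predT iter_addn_0 size_comps; congr (_ * 'C(_, _)); lia.
Qed.

Lemma card_parking_run r : 0 < k -> r <= k ->
  #|[set a : word n | [&& parking a, run a == r & of_type A a]]| = r * 'C(n - r - 1, k - r).
Proof.
move=> k_gt0 lerk; have lekn : k <= n := size_ordered_partition A_part.
pose z := [seq #|F : {set 'I_n}| | F <- A].
have z_gt0 : all (leq 1) z := block_sizes_gt0 A_part.
have sz : size z = k by rewrite size_map.
have surplus : sumn (map predn z) = n - k.
  have := sumn_take_predn z_gt0 (leqnn (size z)).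
  by rewrite !take_oversize ?size_map // (sum_block_sizes A_part); lia.
(* The number of surplus elements in the first [j] blocks: rotating [c] by it keeps every entry
   attached to its surplus element. *)
pose e j := sumn (take j (map predn z)).
apply: (@card_run_of_type _ _ (block_sums (map predn z)) e) => // [c _ | c szc | j c ltj].
- by rewrite size_block_sums size_map.
- by rewrite sumn_block_sums // surplus szc.
rewrite mem_comps => /andP[/eqP szc /eqP smc].
rewrite /e -block_sums_rot ?surplus // -map_rot.
set c' := rot _ c; have smc' : sumn c' = k - r by rewrite sumn_rot.
have szc' : size c' = n - k by rewrite size_rot.
have rotP := ordered_partition_rot A_part j.
have zrotE : rot j z = [seq #|F : {set 'I_n}| | F <- rot j A] by rewrite map_rot.
have sz_enc : size (enc r c') = n by rewrite size_enc smc' szc'; lia.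
have ct_enc : count id (enc r c') = size (rot j A) by rewrite count_enc_true smc' size_rot subnKC.
rewrite parking_bits /= (bits_mkword rotP) // (coim_mkword rotP) // -zrotE.
have smz : sumn (rot j z) = n by rewrite zrotE (sum_block_sizes rotP).
rewrite -[X in iota 1 X]smz parking_enc ?size_rot ?sz ?smc' ?szc' ?subnKC //.
- by rewrite zrotE block_sizes_gt0.
- by rewrite smz szc subnKC.
Qed.

(** The first [r] present values are [0, ..., r - 1] and all later ones are at least [r], so the
    value at [x] is below the run exactly when the block of [x] is among the first [r]. *)
Lemma rook_mkword (B : seq {set 'I_n}) r c (x : 'I_n) :
    ordered_partition B -> size (enc r c) = n -> count id (enc r c) = size B -> val x = 0 ->
  rook (mkword B (enc r c)) = (find (fun F : {set 'I_n} => x \in F) B < r).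
Proof.
move=> B_part size_b count_b x0.
have ltl : find (fun F : {set 'I_n} => x \in F) B < size B by rewrite -has_find has_block.
have -> : rook (mkword B (enc r c)) = (mkword B (enc r c) x < r).
  rewrite /rook run_bits bits_mkword // index_false_enc; apply/existsP/idP => [[j] | ltx].
    by case/andP => /eqP j0; have -> : j = x by apply: val_inj; rewrite /= j0.
  by exists x; rewrite x0 eqxx.
have [t encE] : exists t, enc r c = nseq r true ++ t by case: (c) => [|m c']; eexists.
have ler : r <= n by rewrite -size_b encE size_cat size_nseq leq_addr.
rewrite ffunE; set l := find _ _ in ltl *.
have size_s : size (mask (enc r c) (enum 'I_n)) = size B by rewrite size_mask ?size_enum_ord.
move: size_s; rewrite encE -{1 2}(cat_take_drop r (enum 'I_n)).
have size_tk : size (take r (enum 'I_n)) = r by rewrite size_takel ?size_enum_ord.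
rewrite mask_cat ?size_nseq // mask_true ?size_tk // size_cat size_tk => size_s.
rewrite nth_cat size_tk; case: (ltnP l r) => [ltlr | lerl].
  by rewrite nth_take // nth_enum_ord // (leq_trans ltlr ler).
set y := nth _ _ _; apply/negbTE; rewrite -leqNgt.
have /mem_mask : y \in mask t (drop r (enum 'I_n)).
  by apply: mem_nth; rewrite -(ltn_add2l r) size_s subnKC.
rewrite -(mem_map val_inj) map_drop val_enum_ord drop_iota mem_iota add0n => /andP[le_y _].
exact: le_y.
Qed.

Lemma card_rook_run r : 0 < n -> 0 < k -> r <= k ->
  #|[set a : word n | [&& rook a, run a == r & of_type A a]]| = r * 'C(n - r - 1, k - r).
Proof.
move=> n_gt0 k_gt0 lerk; have lekn : k <= n := size_ordered_partition A_part.
pose P (F : {set 'I_n}) := Ordinal n_gt0 \in F.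
(* All of [sumn c] is put on the one block containing the first position. Only the sum of [c]
   enters, so no compensating rotation is needed. *)
pose f c := [seq P F * sumn c | F <- A].
apply: (@card_run_of_type _ _ f (fun=> 0)) => // [c _ | c szc | j c ltj].
- by rewrite size_map.
- by rewrite sumn_map_indicator count_block // mul1n.
rewrite rot0 mem_comps => /andP[/eqP szc /eqP smc].
have rotP := ordered_partition_rot A_part j.
rewrite (@rook_mkword _ _ _ (Ordinal n_gt0)) ?size_enc ?count_enc_true ?size_rot ?smc ?szc //;
  [| lia..].
rewrite -/P /f -map_rot /stays_pos size_map size_rot -/k.
have hasP : has P (rot j A) := has_block rotP _.
have ltPk : find P (rot j A) < k by rewrite -[k](size_rot j) -has_find.
apply/idP/allP => [lt_r b | pos].
  rewrite mem_iota -map_take sumn_map_indicator => /andP[_ ltbk].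
  case: (ltnP (find P (rot j A)) b) => [ltb | leb]; last first.
    by apply: leq_ltn_trans leb _; apply: leq_trans lt_r (leq_addr _ _).
  have : 0 < count P (take b (rot j A)) by rewrite -has_count has_take.
  (* Once the block is passed, the bound is at least [r + (k - r) = k], which exceeds [b]. *)
  rewrite smc; nia.
(* If the block comes at index [r] or later, the walk has already descended to 0 at [b = r]. *)
rewrite ltnNge; apply/negP => le_r; have := pos r.
rewrite mem_iota (leq_ltn_trans le_r ltPk) -map_take sumn_map_indicator => /(_ isT).
have : ~~ has P (take r (rot j A)) by rewrite has_take // -leqNgt.
by rewrite has_count -eqn0Ngt => /eqP->; rewrite addn0 ltnn.
Qed.

Lemma card_of_type (Q : pred (word n)) :
    0 < k ->
    (forall r, r <= k ->
       #|[set a : word n | [&& Q a, run a == r & of_type A a]]| = r * 'C(n - r - 1, k - r)) ->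
  #|[set a : word n | Q a & of_type A a]| = 'C(n, k.-1).
Proof.
move=> k_gt0 cardQ; have lekn : k <= n := size_ordered_partition A_part.
(* Words of type [A] have run at most [k], so [inord] does not alter the run. *)
rewrite -sum1_card (partition_big (fun a : word n => inord (run a) : 'I_k.+1) predT) //=.
have := sum_run_bin (n - k) k.-1; rewrite prednK // subnK // => <-.
apply: eq_bigr => r _.
have ler : r <= k by rewrite -ltnS.
have -> : n - k + (k - r) - 1 = n - r - 1 by lia.
rewrite -cardQ // sum1dep_card; apply: eq_card => a; rewrite !inE.
case: (Q a) => //=; case aA: (of_type A a); rewrite ?andbF ?andbT //=.
by rewrite -val_eqE /= inordK // ltnS run_le_size.
Qed.

End Counting.

Theorem theorem4p10 (n : nat) (A : seq {set 'I_n}) (r : nat) :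
  0 < n -> ordered_partition A -> 1 <= r <= n ->
  let k := size A in
  (* (i) *)
  (#|[set a : word n | parking a & of_type A a]| = 'C(n, k.-1) /\
   #|[set a : word n | rook a & of_type A a]| = 'C(n, k.-1)) /\
  (* (ii) : r * binom(n-r-1, k-r), which is 0 when k < r *)
  (#|[set a : word n | [&& parking a, run a == r & of_type A a]]|
     = (if r <= k then r * 'C(n - r - 1, k - r) else 0) /\
   #|[set a : word n | [&& rook a, run a == r & of_type A a]]|
     = (if r <= k then r * 'C(n - r - 1, k - r) else 0)).
Proof.
move=> n_gt0 A_part _ k.
have k_gt0 : 0 < k.
  by have := has_block A_part (Ordinal n_gt0); rewrite has_find; apply: leq_ltn_trans.
have parkE r' : r' <= k -> _ := card_parking_run A_part k_gt0.
have rookE r' : r' <= k -> _ := card_rook_run A_part n_gt0 k_gt0.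
split; first by split; apply: card_of_type.
have [lerk | ltkr] := leqP r k; first by rewrite parkE ?rookE.
have no_run (Q : pred (word n)) : #|[set a : word n | [&& Q a, run a == r & of_type A a]]| = 0.
  apply: eq_card0 => a; rewrite !inE; apply/and3P => -[_ /eqP run_a /run_le_size].
  by rewrite run_a leqNgt ltkr.
by rewrite !no_run.
Qed.
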